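(* Let $\boldsymbol{S}$ be a random dataset in $\mathcal{X}^n$ and let $\mathcal{A}$ be a (possibly randomized) algorithm taking as an input a dataset in $\mathcal{X}^n$ and having a range $\mathcal{Y}$. Assume that for some $\beta\ge 0$, $I_\infty^\beta(\boldsymbol{S};\mathcal{A}(\boldsymbol{S}))=k$. For any $\beta'>0$, there exists an algorithm $\mathcal{A}'$ taking as an input a dataset in $\mathcal{X}^n$ such that 1. the output of $\mathcal{A}'$ has randomized description length $k+\log\ln(1/\beta')$; 2. $\Delta((\boldsymbol{S},\mathcal{A}'(\boldsymbol{S})),(\boldsymbol{S},\mathcal{A}(\boldsymbol{S})))\le\beta+\beta'$.
   Context: All random variables take values in finite domains; $\log$ is binary and $\ln$ natural. $\Delta$ denotes statistical (total variation) distance between distributions. The output of a randomized algorithm with output in $\mathcal{Y}$ has randomized description length $k$ if for every fixed setting of the algorithm's random coin flips, the set of its possible outputs (over all inputs) has size at most $2^k$. For jointly distributed $\boldsymbol{X},\boldsymbol{Y}$, $\boldsymbol{X}\times\boldsymbol{Y}$ denotes the random variable obtained by drawing them independently from their marginal distributions. For random variables $\boldsymbol{U},\boldsymbol{V}$ over the same domain $\mathcal{D}$, $$D_\infty^\delta(\boldsymbol{U}\|\boldsymbol{V})=\log\max_{\mathcal{O}\subseteq\mathcal{D},\ \Pr[\boldsymbol{U}\in\mathcal{O}]>\delta}\frac{\Pr[\boldsymbol{U}\in\mathcal{O}]-\delta}{\Pr[\boldsymbol{V}\in\mathcal{O}]},$$ and $I_\infty^\beta(\boldsymbol{X};\bo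ldsymbol{Y})=D_\infty^\beta((\boldsymbol{X},\boldsymbol{Y})\|\boldsymbol{X}\times\boldsymbol{Y})$.
   Formalization: The description length is rounded up: for each setting of the coins there are at most ⌈2^k ln(1/β')⌉ outputs, since the unrounded bound can be below 1 (k = 0, β = 0, β' = 1/2); for β' ≥ 1, where log ln(1/β') is undefined, the bound is ⌈2^k⌉. *)

(* Defs.v *)
(* MathComp / MathComp-Analysis. *)
From HB Require Import structures.
From mathcomp Require Import all_boot all_order all_algebra.
From mathcomp Require Import all_classical all_reals all_analysis.

Set Implicit Arguments.
Unset Strict Implicit.
Unset Printing Implicit Defensive.

Import Order.TTheory GRing.Theory Num.Theory.

Local Open Scope ring_scope.

Record fdist (R : realType) (T : finType) := Fdist {
  pmf :> T -> R;
  pmf_ge0 : forall x, 0 <= pmf x;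
  pmf_sum1 : \sum_(x : T) pmf x = 1 }.

Definition Pr (R : realType) (T : finType) (P : fdist R T) (E : {set T}) : R :=
  \sum_(x in E) P x.

Section Constructions.
Context {R : realType} {T U : finType}.

Definition map_pmf (f : T -> U) (P : fdist R T) (y : U) : R :=
  \sum_(x : T | f x == y) P x.

Lemma map_pmf_ge0 f P y : 0 <= map_pmf f P y.
Proof. by apply: sumr_ge0 => x _; exact: pmf_ge0. Qed.

Lemma map_pmf_sum1 f P : \sum_(y : U) map_pmf f P y = 1.
Proof. by rewrite -[RHS](pmf_sum1 P) [RHS](partition_big f xpredT). Qed.

Definition fdist_map (f : T -> U) (P : fdist R T) : fdist R U :=
  Fdist (map_pmf_ge0 f P) (map_pmf_sum1 f P).

Definition prod_pmf (P : fdist R T) (Q : fdist R U) (z : T * U) : R :=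
  P z.1 * Q z.2.

Lemma prod_pmf_ge0 P Q z : 0 <= prod_pmf P Q z.
Proof. by apply: mulr_ge0; exact: pmf_ge0. Qed.

Lemma prod_pmf_sum1 P Q : \sum_(z : T * U) prod_pmf P Q z = 1.
Proof.
rewrite -(pair_bigA _ (fun x y => P x * Q y)) /= -[RHS](pmf_sum1 P).
by apply: eq_bigr => x _; rewrite -mulr_sumr pmf_sum1 mulr1.
Qed.

Definition fdist_prod (P : fdist R T) (Q : fdist R U) : fdist R (T * U)%type :=
  Fdist (prod_pmf_ge0 P Q) (prod_pmf_sum1 P Q).

End Constructions.

Definition stat_dist (R : realType) (T : finType) (P Q : fdist R T) : R :=
  2^-1 * \sum_(x : T) `|P x - Q x|.

(* As [ln], [log2] is 0 on nonpositive reals. *)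
Definition log2 (R : realType) (x : R) : R := ln x / ln 2.

Definition log2e (R : realType) (x : \bar R) : \bar R :=
  (lne x / (ln 2)%:E)%E.

(* [D_infty^delta(U || V)], with values in the extended reals: a ratio with
   zero denominator is +oo, and the value is -oo when no event has
   U-probability larger than [delta]. *)
Definition approx_max_div (R : realType) (T : finType) (delta : R)
    (U V : fdist R T) : \bar R :=
  log2e (\big[maxe/-oo%E]_(O : {set T} | delta < Pr U O)
           ((Pr U O - delta)%:E / (Pr V O)%:E)%E).

(* [I_infty^beta(X; Y)], where [P] is the joint distribution of [(X, Y)]. *)
Definition approx_max_info (R : realType) (T U : finType) (beta : R)
    (P : fdist R (T * U)%type) : \bar R :=
  approx_max_div beta P (fdist_prod (fdist_map fst P) (fdist_map snd P)).

(* A randomized algorithm draws its coins from a finite probability space,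
   independently of its input, and is deterministic given the coins. *)
Record ralg (R : realType) (D Y : finType) := Ralg {
  coin : finType;
  coin_dist : fdist R coin;
  run : coin -> D -> Y }.

(* The joint distribution of [(S, A(S))]. *)
Definition joint (R : realType) (D Y : finType) (S : fdist R D)
    (A : ralg R D Y) : fdist R (D * Y)%type :=
  fdist_map (fun z : D * coin A => (z.1, run z.2 z.1))
            (fdist_prod S (coin_dist A)).

(* The bound [2 `^ l] is a real number.  To say that there are at most
   [2 `^ l] outputs rounded up to an integer, use the length
   [log2 (Num.ceil (2 `^ l))%:~R], which is [l] when [2 `^ l] is an integer. *)
Definition rand_descr_length (R : realType) (D Y : finType)
    (A : ralg R D Y) (l : R) : Prop :=
  forall c : coin A, #|[set run c s | s : D]|%:R <= 2 `^ l.

(* Main.v *)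
(* Let q be the law of A(S), r_s the law of A(s), and K = 2^k.  On input s, A'
   runs rejection sampling with m = ceil (K ln (1/beta')) shared candidates
   drawn from q, accepting y with probability min (r_s y) (K q y) / (K q y).
   Once the coins are fixed, the output is one of the m candidates.
   A round accepts with probability (1 - b_s) / K, where b_s is the mass of r_s
   exceeding K q, so all rounds fail with probability at most
   beta' ^ (1 - b_s) <= b_s + beta', by convexity of exp.  The error on s is
   then at most b_s + beta'.  Applying the max-information bound to the event
   {(s, y) | r_s y > K q y} shows that b_s averages to at most beta. *)
Require Import Defs.
From mathcomp Require Import all_boot all_order all_algebra.
From mathcomp Require Import all_classical all_reals all_analysis.
From mathcomp Require Import ring lra.

Set Implicit Arguments.
Unset Strict Implicit.
Unset Printing Implicit Defensive.

Import Order.TTheory GRing.Theory Num.Theory.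

Local Open Scope ring_scope.

(** * Total variation distance and joint laws *)

Lemma sum_pair (R : realType) (T U : finType) (F : T * U -> R) :
  \sum_z F z = \sum_x \sum_y F (x, y).
Proof. by rewrite (pair_bigA _ (fun x y => F (x, y))); apply: eq_bigr; case. Qed.

Lemma sum_mul_eq (R : realType) (T : finType) (F : T -> R) t :
  \sum_x F x * (x == t)%:R = F t.
Proof.
rewrite (bigD1 t) //= eqxx mulr1 big1 ?addr0 // => x /negbTE ->.
exact: mulr0.
Qed.

Lemma map_pmfE (R : realType) (T U : finType) (f : T -> U) (P : fdist R T) y :
  fdist_map f P y = \sum_x P x * (f x == y)%:R.
Proof.
rewrite -[LHS]/(map_pmf f P y) /map_pmf big_mkcond.
by apply: eq_bigr => x _; case: eqP => _; rewrite ?mulr1 ?mulr0.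
Qed.

(** Both masses are 1, so the signed differences sum to 0. In this one-sided form, lower bounds on
    [P] suffice. *)
Lemma stat_distE (R : realType) (T : finType) (P Q : fdist R T) :
  stat_dist P Q = \sum_x Num.max (Q x - P x) 0.
Proof.
have -> : \sum_x Num.max (Q x - P x) 0
    = \sum_x (2^-1 * `|P x - Q x| + 2^-1 * (Q x - P x)).
  apply: eq_bigr => x _; have [?|?] := leP (Q x - P x) 0.
    by rewrite ger0_norm; lra.
  by rewrite ltr0_norm; lra.
rewrite big_split /= -!mulr_sumr sumrB !pmf_sum1.
by rewrite subrr mulr0 addr0.
Qed.

Definition law (R : realType) (D Y : finType) (A : ralg R D Y) (s : D) :
  fdist R Y := fdist_map (fun c => run c s) (coin_dist A).

Lemma jointE (R : realType) (D Y : finType) (S : fdist R D) (A : ralg R D Y)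
    s y : joint S A (s, y) = S s * law A s y.
Proof.
rewrite !map_pmfE mulr_sumr.
rewrite sum_pair (bigD1 s) //= [X in _ + X]big1 ?addr0 => [|x /negbTE xs].
  by apply: eq_bigr => c _; rewrite xpair_eqE eqxx mulrA.
by rewrite big1 // => c _; rewrite xpair_eqE xs mulr0.
Qed.

Lemma joint_fst (R : realType) (D Y : finType) (S : fdist R D)
    (A : ralg R D Y) s : fdist_map fst (joint S A) s = S s.
Proof.
rewrite map_pmfE sum_pair.
transitivity (\sum_x (\sum_y joint S A (x, y)) * (x == s)%:R).
  by apply: eq_bigr => x _; rewrite mulr_suml.
rewrite sum_mul_eq; under eq_bigr do rewrite jointE.
by rewrite -mulr_sumr pmf_sum1 mulr1.
Qed.

Lemma stat_dist_joint (R : realType) (D Y : finType) (S : fdist R D)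
    (A B : ralg R D Y) :
  stat_dist (joint S A) (joint S B) =
  \sum_s S s * stat_dist (law A s) (law B s).
Proof.
rewrite {1}/stat_dist mulr_sumr.
rewrite sum_pair; apply: eq_bigr => s _.
rewrite /stat_dist mulrCA -!mulr_sumr; congr (_ * _).
rewrite mulr_sumr; apply: eq_bigr => y _.
by rewrite !jointE -mulrBr normrM (ger0_norm (Defs.pmf_ge0 S s)).
Qed.

(** * Tables of independent bits *)

Section BernoulliTable.
Context {R : realType} {I : finType} (a : I -> R).
Context (a01 : forall i, 0 <= a i <= 1).

(** Acceptance depends on the input, but coins are drawn without seeing it; so one bit per pair
    (input, candidate) is drawn in advance. *)
Definition bernoulli_pmf (h : {ffun I -> bool}) : R :=
  \prod_i (if h i then a i else 1 - a i).

Lemma bernoulli_ge0 h : 0 <= bernoulli_pmf h.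
Proof.
by apply: prodr_ge0 => i _; have /andP[? ?] := a01 i; case: ifP => _ //; lra.
Qed.

Lemma bernoulli_sum1 : \sum_h bernoulli_pmf h = 1.
Proof.
rewrite -(bigA_distr_bigA (fun i b => if b then a i else 1 - a i)).
by rewrite big1 // => i _; rewrite big_bool /=; ring.
Qed.

Definition bernoulli_table : fdist R {ffun I -> bool} :=
  Fdist bernoulli_ge0 bernoulli_sum1.

Lemma bernoulli_tableE i (u v : R) :
  \sum_h bernoulli_table h * (if h i then u else v) = a i * u + (1 - a i) * v.
Proof.
(* The payoff is absorbed into the factor at [i], so the sum over tables splits into a product whose
   other factors are 1. *)
pose F j (b : bool) := (if b then a j else 1 - a j) *
  (if j == i then if b then u else v else 1).
rewrite (eq_bigr (fun h : {ffun I -> bool} => \prod_j F j (h j))); last first.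
  move=> h _; rewrite big_split /=; congr (_ * _).
  by rewrite -big_mkcond big_pred1_eq.
rewrite -(bigA_distr_bigA F) (bigD1 i) //= big_bool /F eqxx /=.
rewrite big1 ?mulr1 // => j /negbTE ->.
by rewrite big_bool /=; ring.
Qed.

End BernoulliTable.

(** * Rejection sampling with shared candidates *)

Section Rejection.
Context {R : realType} {D Y : finType} (q : fdist R Y) (a : D * Y -> R).
Context (a01 : forall z, 0 <= a z <= 1).

Definition accept (s : D) : R := \sum_y q y * a (s, y).

Definition retry (A : ralg R D Y) : ralg R D Y :=
  Ralg (fdist_prod (fdist_prod q (bernoulli_table a01)) (coin_dist A))
    (fun c s => if c.1.2 (s, c.1.1) then c.1.1 else run c.2 s).

(** The coins of [A] are independent of the new candidate and its bit, so after a refusal the output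
    still follows the law of [A]. *)
Lemma law_retry A s y :
  law (retry A) s y = q y * a (s, y) + (1 - accept s) * law A s y.
Proof.
transitivity (\sum_y0 \sum_h \sum_c q y0 * bernoulli_table a01 h *
    coin_dist A c * ((if h (s, y0) then y0 else run c s) == y)%:R).
  by rewrite map_pmfE !sum_pair.
transitivity (\sum_y0 q y0 *
    (a (s, y0) * (y0 == y)%:R + (1 - a (s, y0)) * law A s y)).
  apply: eq_bigr => y0 _; rewrite -(bernoulli_tableE a01 (s, y0)) mulr_sumr.
  apply: eq_bigr => h _; rewrite mulrA; case: ifP => _.
    rewrite -[RHS]mulr1 -(pmf_sum1 (coin_dist A)) mulr_sumr.
    by apply: eq_bigr => c _; ring.
  by rewrite map_pmfE mulr_sumr; apply: eq_bigr => c _; rewrite !mulrA.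
rewrite (eq_bigr (fun y0 => q y0 * a (s, y0) * (y0 == y)%:R +
    (q y0 - q y0 * a (s, y0)) * law A s y)); last by move=> y0 _; ring.
rewrite big_split /= -mulr_suml sumrB pmf_sum1; congr (_ + _).
by rewrite (sum_mul_eq (fun y0 => q y0 * a (s, y0))).
Qed.

Lemma accept_le1 s : accept s <= 1.
Proof.
rewrite -(pmf_sum1 q); apply: ler_sum => y _.
by have /andP[? ?] := a01 (s, y); rewrite ler_piMr ?Defs.pmf_ge0.
Qed.

(* The last candidate is output unconditionally: this avoids a failure symbol,
   which would be one more output, and only makes the law larger than the
   probability of an accepting round. *)
Lemma rejection_sampling m : exists A : ralg R D Y,
  (forall c : coin A, (#|[set run c s | s : D]| <= m.+1)%N) /\
  (forall s y, (\sum_(j < m.+1) (1 - accept s) ^+ j) * (q y * a (s, y))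
     <= law A s y).
Proof.
elim: m => [|m [A [outA lawA]]].
  exists (Ralg q (fun y _ => y)); split=> [c|s y].
    rewrite -(cards1 (c : Y)).
    apply/subset_leq_card/fintype.subsetP => y /imsetP[s _ ->].
    by rewrite inE.
  have /andP[_ a1] := a01 (s, y).
  by rewrite big_ord1 expr0 mul1r map_pmfE /= sum_mul_eq ler_piMr ?Defs.pmf_ge0.
exists (retry A); split=> [[[y h] c]|s y].
  (* Once the coins are fixed, the extra round adds only its own candidate [y]. *)
  apply: (@leq_trans #|y |: [set run c s | s : D]|).
    apply/subset_leq_card/fintype.subsetP => _ /imsetP[s _ ->] /=.
    rewrite !inE; case: ifP => _; first by rewrite eqxx.
    by rewrite imset_f ?orbT.
  by rewrite cardsU1 (leq_add (leq_b1 _) (outA c)).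
rewrite law_retry big_ord_recl expr0 mulrDl mul1r lerD2l.
under eq_bigr do rewrite lift0 exprS.
by rewrite -mulr_sumr -mulrA ler_wpM2l ?lawA // subr_ge0 accept_le1.
Qed.

End Rejection.

(** * Convexity, max-information, and the error on a fixed input *)

Lemma expR_chord (R : realType) (T x : R) : 0 <= x <= 1 ->
  expR (- (T * x)) <= 1 - x + x * expR (- T).
Proof.
move=> x01; pose t : {i01 R} := Itv01 (proj1 (andP x01)) (proj2 (andP x01)).
have := convex_expR t (- T) 0.
by rewrite !convRE expR0 mulr0 addr0 mulr1 /= /unstable.onem mulrN addrC
  [T * x]mulrC.
Qed.

Lemma approx_max_div_bound (R : realType) (T : finType) (delta k : R)
    (U V : fdist R T) : approx_max_div delta U V = k%:E ->
  forall O : {set T}, Pr U O - delta <= 2 `^ k * Pr V O.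
Proof.
rewrite /approx_max_div /log2e; set M := \big[_/_]_(_ | _) _.
have ln2 : 0 < ln 2 :> R by rewrite ln_gt0 ?ltr1n.
have PrV_ge0 O : 0 <= Pr V O by apply: sumr_ge0 => *; exact: Defs.pmf_ge0.
move=> Mk; have {Mk} M_k : M = (2 `^ k)%:E.
  (* A nonpositive or infinite [M] would have an infinite logarithm, whereas [k] is finite. *)
  move: Mk; rewrite /lne inver gt_eqF //; case: M => [r| |].
  - have [r0|r0] := leP r 0; first by rewrite mulNyr sgrV gtr0_sg // mul1e.
    rewrite -EFinM => -[<-]; rewrite /powR pnatr_eq0 /= divfK ?gt_eqF //.
    by rewrite lnK.
  - by rewrite mulyr sgrV gtr0_sg // mul1e.
  - by rewrite mulNyr sgrV gtr0_sg // mul1e.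
move=> O; have [dO|Od] := ltP delta (Pr U O); last first.
  by rewrite (@le_trans _ _ 0) ?mulr_ge0 ?powR_ge0 // subr_le0.
have : ((Pr U O - delta)%:E / (Pr V O)%:E <= M)%E.
  exact: (le_bigmax_cond _ (fun O => (Pr U O - delta)%:E / (Pr V O)%:E)%E).
(* If [Pr V O] is 0, the ratio is +oo and exceeds the finite maximum. *)
rewrite M_k inver; case: eqP => [_|/eqP V0].
  by rewrite mulry gtr0_sg ?subr_gt0 // mul1e.
by rewrite -EFinM lee_fin ler_pdivrMr // lt_def V0 PrV_ge0.
Qed.

(** Here [r] is the target, [L] the output law, [e] a part of [r] lying below [K q], and [p] the
    acceptance probability of a round. *)
Lemma stat_dist_rejection (R : realType) (Y : finType) (L r q : fdist R Y)
    (e : Y -> R) (K T : R) (m : nat) (p := K^-1 * \sum_y e y) :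
  0 < K -> K * T <= m%:R ->
  (forall y, 0 <= e y <= Num.min (r y) (K * q y)) ->
  (forall y, (\sum_(j < m) (1 - p) ^+ j) * (K^-1 * e y) <= L y) ->
  stat_dist L r <= \sum_y (r y - e y) + expR (- T).
Proof.
move=> K0 KTm he lawL.
set G := \sum_(j < m) _ in lawL.
have e_ge0 y : 0 <= e y by have /andP[] := he y.
have e_le y : e y <= r y by have := he y; rewrite le_min => /and3P[].
have e_leq y : e y <= K * q y by have := he y; rewrite le_min => /and3P[].
have Kp : K * p = \sum_y e y by rewrite /p mulrA divff ?gt_eqF // mul1r.
have p_ge0 : 0 <= p.
  by apply: mulr_ge0; [rewrite invr_ge0 ltW | apply: sumr_ge0].
have Kp1 : K * p <= 1 by rewrite Kp -(pmf_sum1 r) ler_sum.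
have p1 : p <= 1.
  rewrite -(ler_pM2l K0) Kp mulr1.
  apply: (@le_trans _ _ (\sum_y K * q y)).
    exact: ler_sum.
  by rewrite -mulr_sumr pmf_sum1 mulr1.
have Gp : G * p = 1 - (1 - p) ^+ m.
  by apply: oppr_inj; rewrite opprB subrX1 -/G addrAC subrr add0r mulNr mulrC.
(* Chain: [1 - p <= expR (- p)], then [K * T <= m], then the chord bound at [K * p]. *)
have fail_le : (1 - p) ^+ m <= 1 - K * p + expR (- T).
  apply: (@le_trans _ _ (expR (- (T * (K * p))))).
    apply: (@le_trans _ _ (expR (- p) ^+ m)).
      by rewrite lerXn2r ?nnegrE ?subr_ge0 ?expR_ge0 // expR_ge1Dx.
    by rewrite -expRM_natl ler_expR mulrN lerN2 mulrA ler_wpM2r // [T * K]mulrC.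
  have Kp01 : 0 <= K * p <= 1 by rewrite Kp1 mulr_ge0 // ltW.
  by rewrite (le_trans (expR_chord T Kp01)) // lerD2l ler_piMl ?expR_ge0.
rewrite stat_distE sumrB pmf_sum1 -Kp.
(* If [K <= G], then [L] covers [e] and misses only the excess of [r] over [e];
   otherwise [G K^-1 e <= r], and only the probability of failure is lost. *)
have [KG|GK] := leP K G.
  apply: (@le_trans _ _ (\sum_y (r y - e y))).
    apply: ler_sum => y _; rewrite ge_max subr_ge0 e_le andbT lerD2l lerN2.
    apply: le_trans (lawL y); rewrite mulrA ler_peMl //.
    by rewrite ler_pdivlMr ?mul1r.
  by rewrite sumrB pmf_sum1 -Kp lerDl expR_ge0.
apply: le_trans fail_le.
have -> : (1 - p) ^+ m = \sum_y (r y - G * (K^-1 * e y)).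
  by rewrite sumrB pmf_sum1 -!mulr_sumr -/p Gp; lra.
apply: ler_sum => y _; rewrite ge_max lerD2l lerN2 lawL /=.
rewrite subr_ge0; apply: le_trans (e_le y).
by rewrite mulrA ler_piMl // ler_pdivrMr // mul1r ltW.
Qed.

Theorem theorem32 (R : realType) (X Y : finType) (n : nat)
    (S : fdist R (n.-tuple X)) (A : ralg R (n.-tuple X) Y) (beta k : R)
    (hbeta : 0 <= beta)
    (hk : approx_max_info beta (joint S A) = k%:E)
    (beta' : R) (hbeta' : 0 < beta') :
  exists A' : ralg R (n.-tuple X) Y,
    rand_descr_length A'
      (log2 (Num.ceil (2 `^ (k + log2 (ln (1 / beta')))))%:~R) /\
    stat_dist (joint S A') (joint S A) <= beta + beta'.
Proof.
set t := 2 `^ _; pose K : R := 2 `^ k; pose T := ln (1 / beta').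
have K0 : 0 < K by rewrite powR_gt0 ?ltr0n.
have t0 : 0 < t by rewrite powR_gt0 ?ltr0n.
have ln2 : 0 < ln 2 :> R by rewrite ln_gt0 ?ltr1n.
have log2K (x : R) : 0 < x -> 2 `^ log2 x = x.
  by move=> x0; rewrite /powR pnatr_eq0 /= /log2 divfK ?gt_eqF // lnK.
have KTt : K * T <= t.
  (* If [1 <= beta'], then [log2 T] is 0 by convention, so [t = K]. *)
  have [T0|T0] := leP T 0.
    by rewrite (@le_trans _ _ 0) ?mulr_ge0_le0 // ltW.
  by rewrite /t powRD ?pnatr_eq0 ?implybT // log2K.
have expT : expR (- T) = beta' by rewrite /T div1r lnV ?posrE // opprK lnK.
(* Written as a successor to match the [m.+1] candidates of [rejection_sampling]. *)
have [m cm] : exists m : nat, Num.ceil t = m.+1%:Z.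
  have : 0 < Num.ceil t by rewrite ceil_gt0.
  by case: (Num.ceil t) => [[|m]|] // _; exists m.
have KTm : K * T <= m.+1%:R.
  by apply: le_trans KTt _; have := ceil_ge t; rewrite cm.
pose q : fdist R Y := fdist_map snd (joint S A).
pose e s y : R := Num.min (law A s y) (K * q y).
pose a z := e z.1 z.2 / (K * q z.2).
have Kq0 y : 0 <= K * q y by rewrite mulr_ge0 ?Defs.pmf_ge0 // ltW.
have a01 z : 0 <= a z <= 1.
  rewrite /a divr_ge0 ?le_min ?Defs.pmf_ge0 ?Kq0 //=.
  have [->|Kq] := eqVneq (K * q z.2) 0; first by rewrite invr0 mulr0.
  by rewrite ler_pdivrMr ?mul1r ?ge_min ?lexx ?orbT // lt_def Kq Kq0.
have qa s y : q y * a (s, y) = K^-1 * e s y.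
  rewrite -[a _]/(e s y / (K * q y)).
  (* When [q y] is 0, so is [e s y], and both sides vanish. *)
  have [q0|qN0] := eqVneq (q y) 0; last first.
    by field; rewrite qN0 gt_eqF.
  by rewrite /e q0 mul0r mulr0 min_r ?Defs.pmf_ge0 // mulr0.
have acceptE s : accept q a s = K^-1 * \sum_y e s y.
  by rewrite mulr_sumr; apply: eq_bigr => y _.
have [A' [outA' lawA']] := rejection_sampling q a01 m.
exists A'; split=> [c|].
  by rewrite cm log2K ?ltr0n // ler_nat.
rewrite stat_dist_joint.
apply: (@le_trans _ _ (\sum_s S s * (\sum_y (law A s y - e s y) + beta'))).
  apply: ler_sum => s _; rewrite ler_wpM2l ?Defs.pmf_ge0 // -expT.
  apply: (stat_dist_rejection (q := q)) K0 KTm _ _ => y.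
    by rewrite /e lexx andbT le_min Defs.pmf_ge0 Kq0.
  by rewrite -acceptE -qa lawA'.
under eq_bigr do rewrite mulrDr.
rewrite big_split -mulr_suml pmf_sum1 mul1r lerD2r.
pose V := fdist_prod (fdist_map fst (joint S A)) q.
pose O := [set z | K * V z < joint S A z].
have VE s y : V (s, y) = S s * q y.
  by rewrite -[LHS]/(fdist_map fst (joint S A) s * q y) joint_fst.
have : Pr (joint S A) O - K * Pr V O <= beta.
  by rewrite lerBlDl -lerBlDr; exact: (approx_max_div_bound hk).
apply: le_trans.
rewrite /Pr mulr_sumr -sumrB [leRHS]big_mkcond sum_pair.
apply: ler_sum => s _; rewrite mulr_sumr; apply: ler_sum => y _.
(* Where [S s] is positive, [O] holds exactly the pairs with [law A s y] above [K * q y]; elsewhere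
   [e s y] equals [law A s y] and nothing is lost. *)
rewrite finset.in_set VE jointE /e mulrCA -mulrBr minEle.
have [Ss0|SsN0] := eqVneq (S s) 0; first by rewrite Ss0 !mul0r ltxx.
have S0 : 0 < S s by rewrite lt_def SsN0 Defs.pmf_ge0.
rewrite ltr_pM2l //.
by case: (leP (law A s y)) => _ //; rewrite subrr mulr0.
Qed.
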